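(* Let $k,n,s\in\mathbb N$ and $\lambda,\varepsilon>0$. There exists $p_0=p_0(k,n,s,\lambda,\varepsilon)<1$ such that if $\Gamma$ is a finite group with $|\Gamma|\ge2$ containing an $s$-step nilpotent subgroup $H$ of index $n$, and $S$ is a generating set of $\Gamma$ of size at most $k$ satisfying \[ \operatorname{diam}_S(\Gamma)\le\frac{\lambda|\Gamma|}{(\log|\Gamma|)^s}, \] then Bernoulli-$p$ bond percolation on $\operatorname{Cay}(\Gamma,S)$ satisfies $\mathbb P_p(x\leftrightarrow y)\ge1-\varepsilon$ for every $p\ge p_0$ and all $x,y\in\Gamma$.
   Context: A group is $s$-step nilpotent if its lower central series ($\Gamma_1=\Gamma$, $\Gamma_{i+1}=[\Gamma_i,\Gamma]$) satisfies $\Gamma_{s+1}=\{\mathrm{id}\}$. $\operatorname{Cay}(\Gamma,S)$ has vertex set $\Gamma$ and edges $\{x,y\}$ with $x=ys$, $s\in S\cup S^{-1}\setminus\{\mathrm{id}\}$; $\operatorname{diam}_S(\Gamma)$ is its diameter. Bernoulli-$p$ bond percolation keeps each edge independently with probability $p$. *)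

(* Defs.v *)
From HB Require Import structures.
From mathcomp Require Import all_boot all_order all_algebra all_fingroup all_solvable.
From mathcomp Require Import all_classical all_reals all_analysis.

Set Implicit Arguments.
Unset Strict Implicit.
Unset Printing Implicit Defensive.

Import Order.TTheory GRing.Theory Num.Theory.

Section Cayley.
Variable gT : finGroupType.
Local Open Scope group_scope.

Definition cay_gens (S : {set gT}) : {set gT} :=
  (S :|: [set t^-1 | t in S]) :\ 1.

Definition cay_edges (S : {set gT}) : {set {set gT}} :=
  [set [set x; x * t] | x in [set: gT], t in cay_gens S].

Definition adj_in (w : {set {set gT}}) : rel gT := fun x y => [set x; y] \in w.

Fixpoint within (w : {set {set gT}}) (m : nat) (x y : gT) : bool :=
  match m with
  | 0 => x == y
  | m'.+1 => within w m' x y || [exists z, within w m' x z && adj_in w z y]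
  end.

(* graph distance in Cay(Γ,S) (equals #|gT| if y unreachable, which does not
   happen when S generates Γ) *)
Definition cay_dist (S : {set gT}) (x y : gT) : nat :=
  find (fun m => within (cay_edges S) m x y) (iota 0 #|gT|).

Definition cay_diam (S : {set gT}) : nat :=
  \max_(x : gT) \max_(y : gT) cay_dist S x y.

Definition perc_conn_prob (R : realType) (S : {set gT}) (p : R) (x y : gT) : R :=
  \sum_(w : {set {set gT}} | w \subset cay_edges S)
     (p ^+ #|w| * (1 - p) ^+ (#|cay_edges S| - #|w|) *
      (connect (adj_in w) x y)%:R)%R.

End Cayley.

(* Main.v *)
(* Suppose [x] and [y] are not joined by open edges, and let [D] contain [x] but
   not [y], with all boundary edges closed and as few of them as possible. Call
   two edges near if they lie in a common ball of a constant radius [L], and let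
   [C] be a component of the boundary of [D] for nearness. Every closed walk of
   length at most [L] crosses [C] an even number of times, so the short relations
   of the group persist in the group [N] generated by the lifts of the generators
   to the double cover of the Cayley graph that changes sheet across [C]. By
   Schreier's lemma the preimage [G] of [H] in [N] is again nilpotent of step [s].

   If the cover is trivial, then [C] is itself the boundary of a set, and
   minimality makes it the whole boundary of [D]. The translates of a connected
   cut that do not come near it are nested with it, so the smaller side of [D] has
   [O(|C|^2)] points; hence [C] contains one of the first [O(|C|^2)] edges of a
   fixed path from [x] to [y] or back. Otherwise a nontrivial deck transformation
   is a product of [O(diam)] lifts, and at most [s] commutators with short
   generators of [G] turn it into a nontrivial deck transformation centralising
   [G], still a product of [O(diam)] lifts. It changes sheet above a full coset of
   [H], so [|H| <= O(diam * |C|)] and [|C|] is at least a constant times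
   [log |gT|].

   There are at most exponentially many connected sets of [m] edges with a given
   root, so a union bound over the roots just found shows that the probability of
   disconnection is small when [1 - p] is small. *)
Require Import Defs.
From HB Require Import structures.
From mathcomp Require Import all_boot all_order all_algebra all_fingroup all_solvable.
From mathcomp Require Import zify ring.
Set Implicit Arguments.
Unset Strict Implicit.
Unset Printing Implicit Defensive.
Import Order.TTheory GRing.Theory Num.Theory.

(** * Powers of a set, Schreier generators and commutators of bounded length *)

Section SetPowers.
Variable gT : finGroupType.
Implicit Types (X A B : {set gT}) (G H : {group gT}).
Local Open Scope group_scope.

Lemma expsg_homo X i j : 1 \in X -> i <= j -> X ^+ i \subset X ^+ j.
Proof.
move=> X1 leij; rewrite -(subnKC leij); elim: (j - i) => [|d IHd]; first by rewrite addn0.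
apply: subset_trans IHd _; rewrite addnS expgSr; apply/subsetP=> x Xx.
by rewrite -[x]mulg1 mem_mulg.
Qed.

Lemma one_expsg X i : 1 \in X -> 1 \in X ^+ i.
Proof. by move=> X1; apply: (subsetP (expsg_homo X1 (leq0n i))); rewrite inE. Qed.

Lemma mem_expsgD X i j x y :
  x \in X ^+ i -> y \in X ^+ j -> x * y \in X ^+ (i + j).
Proof. by move=> Xx Xy; rewrite expgD mem_mulg. Qed.

Lemma mem_expsgS X i x y : x \in X ^+ i -> y \in X -> x * y \in X ^+ i.+1.
Proof. by move=> Xx Xy; rewrite expgSr mem_mulg. Qed.

Lemma mem_expsgV X i x :
  (forall y, y \in X -> y^-1 \in X) -> x \in X ^+ i -> x^-1 \in X ^+ i.
Proof.
move=> XV; elim: i x => [|i IHi] x; first by rewrite !inE => /eqP->; rewrite invg1.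
rewrite expgSr => /mulsgP[y z Xy Xz ->]; rewrite invMg -expgSr expgS.
by apply: mem_mulg; [apply: XV | apply: IHi].
Qed.

Lemma card_expsg X i : #|X ^+ i| <= #|X| ^ i.
Proof.
elim: i => [|i IHi]; first by rewrite cards1.
rewrite expgS expnS; apply: leq_trans (leq_mul (leqnn #|X|) IHi).
rewrite -cardsX; apply: leq_trans (leq_imset_card (fun u => u.1 * u.2) _).
apply/subset_leq_card/subsetP=> _ /mulsgP[x y Xx Xy ->].
by apply/imsetP; exists (x, y); rewrite // inE Xx.
Qed.

Lemma expsg_sub X G i : X \subset G -> X ^+ i \subset G.
Proof.
move=> sXG; elim: i => [|i IHi]; first by rewrite sub1G.
by rewrite expgS mul_subG.
Qed.

(** The sets [H * X ^+ i] are unions of right cosets of [H]. Each step either adds a coset or leaves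
    a set closed under right multiplication by [X], hence all of [<<X>>]; only [n] cosets are
    available. *)
Lemma gen_sub_mul_expsg X H n :
  1 \in X -> H \subset <<X>> -> #|<<X>> : H| <= n -> <<X>> \subset H * X ^+ n.
Proof.
move=> X1 sHX len.
have step i : <<X>> \subset H * X ^+ i \/ i.+1 * #|H| <= #|H * X ^+ i|.
  elim: i => [|i [IHi|IHi]]; first by right; rewrite mulg1 mul1n.
    left; apply: subset_trans IHi _; apply: mulgS; exact: expsg_homo.
  have [sub|] := boolP (H * X ^+ i.+1 \subset H * X ^+ i).
    left; rewrite (subset_trans _ (mulgS H (expsg_homo X1 (leqnSn i)))) //.
    have stab y : y \in H * X ^+ i -> y *: <<X>> \subset H * X ^+ i.
      move=> Hy; apply/subsetP=> _ /lcosetP[z Xz ->].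
      have [m [c Xc ->]] := gen_prodgP Xz.
      elim: m c Xc => [|m IHm] c Xc; first by rewrite big_ord0 mulg1.
      rewrite big_ord_recr /= mulgA; apply: (subsetP sub).
      rewrite expgSr mulgA mem_mulg ?Xc // IHm // => j; exact: Xc.
    by rewrite -[<<X>>]lcoset1 -/(lcoset _ _) stab // -[1]mulg1 mem_mulg ?one_expsg.
  case/subsetPn=> z Xz nXz; right.
  rewrite mulSn addnC -{2}(card_rcoset H z).
  apply: leq_trans (leq_add IHi (leqnn _)) _.
  have dis : [disjoint H * X ^+ i & H :* z].
    rewrite -setI_eq0; apply/eqP/setP=> u; rewrite !inE; apply/negP.
    case/andP=> /mulsgP[h x Hh Xx ->] /rcosetP[h' Hh' e].
    case/negP: nXz; suff ->: z = (h'^-1 * h) * x by rewrite mem_mulg ?groupM ?groupV.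
    by rewrite -mulgA e mulKg.
  rewrite -cardsUI.
  rewrite (_ : _ :&: _ = set0) ?cards0 ?addn0; last by apply/eqP; rewrite setI_eq0.
  apply: subset_leq_card; rewrite subUset mulgS ?expsg_homo //=.
  case/mulsgP: Xz => h x Hh Xx ->; apply/subsetP=> _ /rcosetP[h' Hh' ->].
  by rewrite mulgA mem_mulg ?groupM.
have [//|] := step n.
have: #|H * X ^+ n| <= #|<<X>>|.
  by rewrite subset_leq_card // mul_subG // expsg_sub ?subset_gen.
move: len (Lagrange sHX) (cardG_gt0 H).
set u := #|H|; set v := #|_ : _|; set q := #|_|; move=> len <- u0 le1 le2.
by exfalso; nia.
Qed.

(** Schreier's lemma with lengths: a product of letters is kept in the form of an element of [<<Y>>]
    times a representative in [X ^+ d], and each new letter splits off a factor in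
    [X ^+ (d + d).+1]. *)
Lemma schreier_gen X H d :
  1 \in X -> (forall y, y \in X -> y^-1 \in X) ->
  H \subset <<X>> -> <<X>> \subset H * X ^+ d ->
  <<H :&: X ^+ (d + d).+1>> = H.
Proof.
move=> X1 XV sHX sXH; set Y := H :&: _.
have X_Y x : x \in H -> x \in X ^+ (d + d).+1 -> x \in <<Y>>.
  by move=> Hx Xx; apply: mem_gen; rewrite inE Hx.
have key z : z \in <<X>> -> z \in <<Y>> * X ^+ d.
  move=> Xz; have [m [c Xc ->]] := gen_prodgP Xz.
  elim: m c Xc {z Xz} => [|m IHm] c Xc.
    by rewrite big_ord0 -[1]mulg1 mem_mulg ?one_expsg.
  rewrite big_ord_recr /=.
  have /mulsgP[h y Yh Xy ->] := IHm (fun j => c (widen_ord (leqnSn m) j)) (fun j => Xc _).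
  set x := c _; have Xx : x \in X by apply: Xc.
  have Gyx : y * x \in <<X>>.
    apply: groupM; last exact: mem_gen.
    exact: (subsetP (expsg_sub (G := <<X>>%G) d (subset_gen X))).
  have /mulsgP[h' r Hh' Xr e] := subsetP sXH _ Gyx.
  rewrite -mulgA e mulgA mem_mulg // groupM // X_Y //.
  have ->: h' = y * x * r^-1 by rewrite e mulgK.
  by rewrite -addSn mem_expsgD ?mem_expsgS // mem_expsgV.
apply/eqP; rewrite eqEsubset gen_subG subsetIl /=; apply/subsetP=> h Hh.
have /mulsgP[y x Yy Xx e] := key _ (subsetP sHX _ Hh).
rewrite e groupM // X_Y //; last first.
  by apply: (subsetP (expsg_homo X1 _) _ Xx); rewrite leqW ?leq_addr.
have ->: x = y^-1 * h by rewrite e mulKg.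
rewrite groupM ?groupV //; apply: subsetP Yy.
by rewrite gen_subG subsetIl.
Qed.

Lemma commg_expsg X i a x y : (forall z, z \in X -> z^-1 \in X) ->
  x \in X ^+ i -> y \in X ^+ a -> [~ x, y] \in X ^+ (i + i + (a + a)).
Proof.
move=> XV Xx Xy; rewrite commgEl conjgE.
rewrite (_ : (i + i + (a + a) = i + (a + (i + a)))%N); last by lia.
by rewrite !mem_expsgD ?mem_expsgV.
Qed.

(** The [g] in [G] with [[~ x, g]] in [Z] form a subgroup, because [[~ x, g * h] = [~ x, h] *
    [~ x, g] ^ h]. *)
Lemma commg_gen_sub Y (Z G : {group gT}) x :
  <<Y>> = G -> Z <| G ->
  (forall y, y \in Y -> [~ x, y] \in Z) -> forall g, g \in G -> [~ x, g] \in Z.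
Proof.
move=> genY /andP[_ nZG] Yx.
have gS : group_set [set g in G | [~ x, g] \in Z].
  apply/group_setP; split=> [|g h]; first by rewrite inE group1 commg1 group1.
  rewrite !inE => /andP[Gg Zg] /andP[Gh Zh]; rewrite groupM //= commgMJ groupM //.
  by rewrite memJ_norm // (subsetP nZG).
move=> g; rewrite -genY => Yg.
suff: g \in [set g in G | [~ x, g] \in Z] by rewrite inE => /andP[].
have sY : Y \subset [set g in G | [~ x, g] \in Z].
  by apply/subsetP=> y Yy; rewrite inE -genY mem_gen // Yx.
by move: Yg; apply/subsetP; rewrite -(gen_subG _ (Group gS)) in sY.
Qed.

(** By induction on [j], commutators of weight [s - j + 1] in the generators lie in the [j]-th term
    of the upper central series; for [j = s] these are the generators themselves. *)
Lemma lcn_eq1_gen Y G s :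
  <<Y>> = G -> iter s (fun A => commg_set A Y) Y \subset [1] -> 'L_s.+1(G) = 1.
Proof.
move=> genY W1; apply/eqP; rewrite ucn_lcnP eqEsubset ucn_sub /=.
have sYG : Y \subset G by rewrite -genY subset_gen.
have WG i : iter i (fun A => commg_set A Y) Y \subset G.
  elim: i => //= i IHi; apply/subsetP=> _ /imset2P[c y Wc Yy ->].
  by apply: groupR; [apply: (subsetP IHi) | apply: (subsetP sYG)].
suff key j : j <= s -> iter (s - j) (fun A => commg_set A Y) Y \subset 'Z_j(G).
  by rewrite -{1}genY gen_subG; have := key s (leqnn s); rewrite subnn.
elim: j => [|j IHj] ltjs; first by rewrite subn0 ucn0.
apply/subsetP=> c Wc; rewrite ucnSnR inE (subsetP (WG _) _ Wc) /=.
rewrite gen_subG; apply/subsetP=> _ /imset2P[_ g /set1P-> Gg ->].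
apply: (commg_gen_sub genY (ucn_normal j G)) => // y Yy.
apply: (subsetP (IHj (ltnW ltjs))); rewrite -(subnSK ltjs) /=.
by apply/imset2P; exists c y.
Qed.

(* Commuting with generators until one hits the centre at most doubles the length at each step. *)
Lemma short_central_elt X Y G (K : {group gT}) s a l c :
    (forall z, z \in X -> z^-1 \in X) ->
    <<Y>> = G -> Y \subset X ^+ a -> 'L_s.+1(G) = 1 -> G \subset 'N(K) ->
    c \in G -> c \in K -> c != 1 -> c \in X ^+ l ->
  0 < s /\ exists d, [/\ d \in 'C(G), d \in K, d != 1
            & exists2 j, j <= 2 ^ s * (l + (a + a)) & d \in X ^+ j].
Proof.
move=> XV genY YX L1 nKG Gc Kc c1 Xc; split.
  by case: s L1 => // L1; case/negP: c1; rewrite lcn1 in L1; rewrite L1 inE in Gc.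
have: exists2 i, c \in 'L_i.+1(G) & i + s >= s by exists 0; rewrite ?lcn1.
(* Here [j] counts the commutators still allowed: [c] lies in the [i.+1]-st term of the lower
   central series with [s <= i + j], and the length bound becomes [2 ^ j * (l + (a + a))]. *)
move: {2 3}s => j [i Li]; elim: j i c l Li Gc Kc c1 Xc => [|j IHj] i c l Li Gc Kc c1 Xc le.
  case/negP: c1; rewrite addn0 in le.
  by have := subsetP (lcn_sub_leq G (leq_ltn_trans le (ltnSn i))) _ Li; rewrite L1 inE.
have [comm|] := boolP [forall y in Y, [~ c, y] == 1].
  exists c; split=> //; last by exists l => //; rewrite mulnDr (leq_trans _ (leq_addr _ _)) // leq_pmull ?expn_gt0.
  rewrite -genY cent_gen; apply/centP=> y Yy; apply/commgP.
  by have /forall_inP/(_ _ Yy) := comm.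
rewrite negb_forall_in => /exists_inP[y Yy cy1].
have Gy : y \in G by rewrite -genY mem_gen.
have [||||||d [Cd Kd d1 [m lem Xm]]] := IHj i.+1 [~ c, y] (l + l + (a + a)).
- by rewrite lcnSn mem_commg.
- by rewrite groupR.
- by rewrite commgEl groupM ?groupV // memJ_norm ?(subsetP nKG).
- by [].
- by rewrite commg_expsg // (subsetP YX).
- by rewrite addSnnS.
(* Replacing [l] by [l + l + (a + a)] exactly doubles [l + (a + a)]. *)
exists d; split=> //; exists m => //; apply: leq_trans lem _.
by rewrite expnS -mulnA mulnCA leq_mul2l; apply/orP; right; clear; lia.
Qed.

End SetPowers.

(** * The double cover that changes sheet across a set of edges *)

Section DoubleCover.
Variables (gT : finGroupType) (T : {set gT}) (C : {set {set gT}}).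
Implicit Types (H M : {group gT}) (u : gT * bool) (f g : {perm gT * bool}).
Local Open Scope group_scope.

Hypothesis TV : forall t, t \in T -> t^-1 \in T.

Local Notation ball := (1 |: T).

Lemma ballV t : t \in ball -> t^-1 \in ball.
Proof. by rewrite !inE => /orP[/eqP->|/TV->]; rewrite ?invg1 ?eqxx ?orbT. Qed.

Lemma gen_ball : <<T>> = [set: gT] -> <<ball>> = [set: gT].
Proof.
by move=> genT; apply/eqP; rewrite eqEsubset subsetT -genT gen_subG sub_gen ?subsetUr.
Qed.

(** The lift of right multiplication by [t] to the double cover. As edges are unordered, the lifts
    of [t] and [t^-1] are mutually inverse. *)
Definition lift_fun t u := (u.1 * t, u.2 (+) ([set u.1; u.1 * t] \in C)).

Lemma lift_fun_inj t : injective (lift_fun t).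
Proof.
by case=> v b [v' b'] [/mulIg-> /addIb->].
Qed.

Definition lift t : {perm gT * bool} := perm (@lift_fun_inj t).

Lemma liftE t v b : lift t (v, b) = (v * t, b (+) ([set v; v * t] \in C)).
Proof. by rewrite permE. Qed.

Lemma liftV t : (lift t)^-1 = lift t^-1.
Proof.
apply/eqP; rewrite eq_invg_mul; apply/eqP/permP=> -[v b].
by rewrite permM !liftE perm1 mulgK [[set v * t; v]]setUC -addbA addbb addbF.
Qed.

(* Elements of [cover_set] act by [(v, b) |-> (v * base f, b (+) phi v)]; such an [f]
   is a deck transformation when [base f = 1]. *)
Definition base f : gT := (f (1, false)).1.

Definition cover_set :=
  [set f : {perm gT * bool} | [forall u : gT * bool, f u == (u.1 * base f, u.2 (+) (f (u.1, false)).2)]].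

Lemma coverP f :
  reflect (forall v b, f (v, b) = (v * base f, b (+) (f (v, false)).2)) (f \in cover_set).
Proof.
rewrite inE; apply: (iffP forallP) => [fP v b | fP [v b]]; first exact/eqP/(fP (v, b)).
exact/eqP/fP.
Qed.

Lemma base_morphM : {in cover_set &, {morph base : f g / f * g}}.
Proof.
move=> f g /coverP Cf /coverP Cg; rewrite /base permM [f _]surjective_pairing Cg.
by [].
Qed.

Lemma base1 : base 1 = 1. Proof. by rewrite /base perm1. Qed.

Lemma cover_group_set : group_set cover_set.
Proof.
apply/group_setP; split=> [|f g Cf Cg].
  by apply/coverP=> v b; rewrite base1 !perm1 mulg1 addbF.
apply/coverP=> v b; rewrite base_morphM //; move/coverP: Cf => Cf; move/coverP: Cg => Cg.
rewrite !permM; have := Cf v b; have := Cf v false.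
case: (f (v, false)) => w c /(congr1 fst) /= -> -> /=.
by rewrite Cg [g (_, c)]Cg /= mulgA addbA.
Qed.
Canonical cover_group := Group cover_group_set.
Canonical base_morphism := Morphism base_morphM.

Lemma lift_cover t : lift t \in cover_set.
Proof. by apply/coverP=> v b; rewrite /base !liftE /= mul1g. Qed.

Lemma base_lift t : base (lift t) = t.
Proof. by rewrite /base liftE mul1g. Qed.

Definition lifts : {set {perm gT * bool}} := 1 |: lift @: T.

Lemma lifts1 : 1 \in lifts. Proof. by rewrite setU11. Qed.

Lemma mem_lift t : t \in T -> lift t \in lifts.
Proof. by move=> Tt; rewrite inE imset_f ?orbT. Qed.

Lemma liftsV f : f \in lifts -> f^-1 \in lifts.
Proof.
rewrite !inE => /orP[/eqP->|/imsetP[t Tt ->]]; rewrite ?invg1 ?eqxx // liftV.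
by rewrite imset_f ?orbT ?TV.
Qed.

Lemma lifts_cover : lifts \subset cover_set.
Proof.
apply/subsetP=> f; rewrite in_setU1 => /orP[/eqP->|/imsetP[t _ ->]]; last exact: lift_cover.
exact: group1.
Qed.

Lemma expsg_lifts_cover i : lifts ^+ i \subset cover_set.
Proof. exact: (expsg_sub (G := cover_group) i lifts_cover). Qed.

Lemma gen_lifts_cover : <<lifts>> \subset cover_set.
Proof. by rewrite (gen_subG _ cover_group) lifts_cover. Qed.

Lemma expsg_lifts_gen i : lifts ^+ i \subset <<lifts>>.
Proof. exact: (expsg_sub (G := <<lifts>>%G) i (subset_gen _)). Qed.

Lemma expsg_ball_lift i x : x \in ball ^+ i -> exists2 f, f \in lifts ^+ i & base f = x.
Proof.
elim: i x => [|i IHi] x; first by move=> /set1P->; exists 1; rewrite ?base1 ?inE.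
rewrite expgSr => /mulsgP[y t By]; rewrite in_setU1 => Bt ->.
have [f Xf <-] := IHi _ By.
have [g Xg <-]: exists2 g, g \in lifts & base g = t.
  case/orP: Bt => [/eqP->|Tt]; first by exists 1; rewrite ?base1 ?lifts1.
  by exists (lift t); rewrite ?base_lift ?mem_lift.
exists (f * g); first exact: mem_expsgS.
apply: base_morphM; [exact: (subsetP (expsg_lifts_cover i)) | exact: (subsetP lifts_cover)].
Qed.

(** A single lift changes sheet only above endpoints of edges of [C], at most two per edge; in a
    product these sets are translated, and overlaps cancel. *)
Lemma cover_support f i : (forall e, e \in C -> #|e| <= 2) ->
  f \in lifts ^+ i -> #|[set v | (f (v, false)).2]| <= 2 * i * #|C|.
Proof.
move=> C2; elim: i f => [|i IHi] f.
  move/set1P->; rewrite muln0 leqn0 cards_eq0; apply/eqP/setP=> v.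
  by rewrite !inE perm1.
rewrite expgSr => /mulsgP[g h Xg Xh ->].
have Ch : #|[set v | (h (v, false)).2]| <= 2 * #|C|.
  move: Xh; rewrite in_setU1 => /orP[/eqP->|/imsetP[t _ ->]].
    by rewrite (_ : [set v | _] = set0) ?cards0 //; apply/setP=> v; rewrite !inE perm1.
  apply: (@leq_trans #|cover C|).
    apply/subset_leq_card/subsetP=> v; rewrite inE liftE /= => Cv.
    by apply/bigcupP; exists [set v; v * t]; rewrite // set21.
  apply: leq_trans (leq_card_cover C).1 _.
  by rewrite mulnC -sum_nat_const; apply: leq_sum => e /C2.
have /coverP hP := subsetP lifts_cover _ Xh.
have /coverP gP := subsetP (expsg_lifts_cover i) _ Xg.
have sub : [set v | ((g * h) (v, false)).2] \subset
    [set v | (g (v, false)).2] :|: (fun v => v * (base g)^-1) @: [set v | (h (v, false)).2].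
  apply/subsetP=> v; rewrite !inE permM gP hP addFb /=.
  case: (g _).2 => //= hv; apply/imsetP; exists (v * base g); last by rewrite mulgK.
  by rewrite inE.
apply: leq_trans (subset_leq_card sub) _.
apply: leq_trans (leq_card_setU _ _).1 _.
have le2 := leq_imset_card (fun v => v * (base g)^-1) [set v | (h (v, false)).2].
by apply: leq_trans (leq_add (IHi _ Xg) (leq_trans le2 Ch)) _; rewrite -mulnDl mulnSr.
Qed.

Definition cover_pre M := (<<lifts>> :&: base @*^-1 M)%G.

Lemma mem_cover_pre M f : (f \in cover_pre M) = (f \in <<lifts>>) && (base f \in M).
Proof.
rewrite inE; apply/andb_id2l => Nf.
have Cf := subsetP gen_lifts_cover _ Nf.
by apply/morphpreP/idP => [[]//|Mf]; split.
Qed.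

(** Coset representatives of [M] lift to elements of [lifts ^+ d], so the covering by cosets lifts
    and Schreier's lemma applies. *)
Lemma cover_pre_schreier M d : [set: gT] \subset M * ball ^+ d ->
  <<cover_pre M :&: lifts ^+ (d + d).+1>> = cover_pre M.
Proof.
move=> sM; apply: schreier_gen => //; [exact: lifts1 | exact: liftsV | exact: subsetIl |].
apply/subsetP=> f Nf.
have /mulsgP[m b Mm Bb e] := subsetP sM (base f) (in_setT _).
have [g Xg gb] := expsg_ball_lift Bb.
have Ng := subsetP (expsg_lifts_gen d) _ Xg.
rewrite -(mulgKV g f) mem_mulg //.
rewrite mem_cover_pre groupM ?groupV //=.
rewrite (morphM base_morphism) ?(morphV base_morphism) ?groupV /= ?(subsetP gen_lifts_cover) //.
by rewrite e gb mulgK.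
Qed.

Lemma large_of_nontrivial_cover H n s d :
    (forall e, e \in C -> #|e| <= 2) ->
    <<T>> = [set: gT] -> [set: gT] \subset ball ^+ d -> #|[set: gT] : H| = n ->
    'L_s.+1(H) = 1 ->
    (forall f, f \in lifts ^+ (2 ^ s * (3 * (n + n).+1)) -> base f = 1 -> f = 1) ->
    (exists f, [/\ f \in <<lifts>>, base f = 1 & f != 1]) ->
  0 < s /\ #|H| <= 2 * (2 ^ s * ((d + d).+1 + ((n + n).+1 + (n + n).+1))) * #|C|.
Proof.
move=> C2 genT sd iH L1 loc [f0 [Nf0 bf0 f01]].
have genB := gen_ball genT.
have sn : [set: gT] \subset H * ball ^+ n.
  rewrite -genB; apply: gen_sub_mul_expsg; rewrite ?setU11 ?genB ?subsetT //.
  by rewrite iH.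
set a := (n + n).+1; pose G := cover_pre H; pose K := cover_pre 1%G.
pose Y := G :&: lifts ^+ a.
have genY : <<Y>> = G by apply: cover_pre_schreier.
have genK : <<K :&: lifts ^+ (d + d).+1>> = K.
  by apply: cover_pre_schreier; rewrite mul1g.
have inG f : f \in G -> f \in cover_set.
  by rewrite mem_cover_pre => /andP[/(subsetP gen_lifts_cover)].
(* For commutators of weight [i + 1] in [Y], the length plus [a + a] doubles at each stage, starting
   from [3 * a]. When [i = s] the base is trivial and [loc] applies. *)
have W i c : c \in iter i (fun A => commg_set A Y) Y ->
    [/\ c \in G, base c \in 'L_i.+1(H)
      & exists2 j, j + (a + a) <= 2 ^ i * (3 * a) & c \in lifts ^+ j].
  elim: i c => [|i IHi] c /=.
    case/setIP=> Gc Xc; split=> //; first by move: Gc; rewrite mem_cover_pre lcn1 => /andP[].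
    by exists a => //; clear; lia.
  case/imset2P=> b y /IHi[Gb Hb [j lej Xb]] /setIP[Gy Xy] ->; split; first by rewrite groupR.
    rewrite (morphR base_morphism) ?inG // lcnSn mem_commg //.
    by move: Gy; rewrite mem_cover_pre => /andP[].
  exists (j + j + (a + a)); last exact: commg_expsg liftsV Xb Xy.
  by rewrite expnS; move: lej; clear; lia.
have nilG : 'L_s.+1(G) = 1.
  apply: (lcn_eq1_gen genY); apply/subsetP=> c /W[Gc]; rewrite L1 => /set1P bc [j lej Xc].
  apply/set1P/loc => //; apply: (subsetP (expsg_homo lifts1 _) _ Xc).
  by apply: leq_trans lej; rewrite leq_addr.
have sKG : K \subset G.
  by apply/subsetP=> f; rewrite !mem_cover_pre => /andP[-> /set1P->] /=.
have nKG : G \subset 'N(K).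
  apply/subsetP=> g Gg; rewrite inE; apply/subsetP=> _ /imsetP[f Kf ->].
  have Gf := subsetP sKG _ Kf; move: Kf (groupJ Gf Gg); rewrite !mem_cover_pre.
  case/andP=> _ /set1P bf /andP[-> _] /=.
  by rewrite (morphJ base_morphism) ?inG //= bf conj1g inE.
(* The deck group [K] is nontrivial and generated by its elements of length at most [(d + d).+1], so
   one of these is nontrivial. *)
have [c Kc c1]: exists2 c, c \in K :&: lifts ^+ (d + d).+1 & c != 1.
  case: (boolP [forall c in K :&: lifts ^+ (d + d).+1, c == 1]); last first.
    by rewrite negb_forall_in => /exists_inP.
  move/forall_inP=> noc.
  case/negP: f01; rewrite -in_set1 -[[set 1]]/(1%G : {set _}).
  have: f0 \in K by rewrite mem_cover_pre Nf0 bf0 group1.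
  rewrite -genK; apply/subsetP; rewrite gen_subG; apply/subsetP=> c /noc.
  by move/eqP->; rewrite inE.
have [Kc' Xc] := setIP Kc.
have [s0 [f [cGf Kf f1 [j lej Xf]]]] :=
  short_central_elt liftsV genY (subsetIr _ _) nilG nKG (subsetP sKG _ Kc') Kc' c1 Xc.
split=> //; apply: leq_trans (leq_mul (leq_mul (leqnn 2) lej) (leqnn #|C|)).
apply: leq_trans (cover_support C2 Xf).
have /coverP fP := inG _ (subsetP sKG _ Kf).
have bf : base f = 1 by move: Kf; rewrite mem_cover_pre => /andP[_ /set1P].
have [v0 fv0]: exists v0, (f (v0, false)).2.
  apply/existsP; apply: contraR f1; rewrite negb_exists => /forallP nf.
  by apply/eqP/permP=> -[v b]; rewrite fP bf (negPf (nf v)) mulg1 addbF perm1.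
(* Each [h] in [H] has a lift [g] in [G]. Since [f] commutes with [g] and flips the sheet above
   [v0], it also flips the sheet above [v0 * h]. *)
rewrite -(card_lcoset H v0); apply/subset_leq_card/subsetP=> _ /lcosetP[h Hh ->].
have [g Xg bg] := expsg_ball_lift (subsetP sd h (in_setT h)).
have Gg : g \in G by rewrite mem_cover_pre bg Hh (subsetP (expsg_lifts_gen d)).
have /coverP gP := inG _ Gg.
have := congr1 (fun q : {perm _} => (q (v0, false)).2) (centP cGf _ Gg).
rewrite !permM fP bf mulg1 fv0 /= gP [g (v0, false)]gP fP bg addFb /= inE.
by case: (g _).2; case: (f _).2.
Qed.

(** Without nontrivial deck transformations each vertex is the base of exactly one element of
    [<<lifts>>]; [D] collects the vertices whose element carries [(1, false)] to the sheet
    [true]. *)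
Lemma coboundary_of_trivial_cover : <<T>> = [set: gT] ->
    (forall f, f \in <<lifts>> -> base f = 1 -> f = 1) ->
  exists D : {set gT}, forall v t, t \in T ->
    ([set v; v * t] \in C) = (v \in D) (+) (v * t \in D).
Proof.
move=> genT triv.
have lft v : exists2 f, f \in <<lifts>> & base f = v.
  have: v \in <<ball>> by rewrite gen_ball ?inE.
  have := @gen_sub_mul_expsg _ ball 1%G #|<<ball>> : 1%G| (setU11 _ _) (sub1G _) (leqnn _).
  rewrite mul1g => /subsetP/[apply] /expsg_ball_lift[f Xf bf]; exists f => //.
  exact: subsetP (expsg_lifts_gen _) _ Xf.
have uni f g : f \in <<lifts>> -> g \in <<lifts>> -> base f = base g -> f = g.
  move=> Nf Ng e; apply/eqP; rewrite eq_mulgV1; apply/eqP/triv; first by rewrite groupM ?groupV.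
  rewrite (morphM base_morphism) ?(morphV base_morphism) ?groupV /= ?(subsetP gen_lifts_cover) //.
  by rewrite e mulgV.
exists [set v | [exists f : {perm gT * bool} in <<lifts>>, f (1, false) == (v, true)]] => v t Tt.
have [f Nf bf] := lft v.
have Nt : lift t \in <<lifts>> by rewrite mem_gen ?mem_lift.
have E g : g \in <<lifts>> ->
    (base g \in [set v | [exists f : {perm gT * bool} in <<lifts>>, f (1, false) == (v, true)]]) = (g (1, false)).2.
  move=> Ng; rewrite inE; apply/exists_inP/idP => [[h Nh /eqP hE]|g1].
    by rewrite (uni g h) ?hE // /base hE.
  by exists g => //; rewrite [g _]surjective_pairing g1.
have bft : base (f * lift t) = v * t.
  by rewrite base_morphM ?base_lift ?bf ?lift_cover // (subsetP gen_lifts_cover).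
move: (E _ Nf) (E _ (groupM Nf Nt)); rewrite bf bft => -> ->.
rewrite permM [f _]surjective_pairing -/(base f) bf liftE /=.
by rewrite addbA addbb addFb.
Qed.

End DoubleCover.

Section LocalCover.
Variables (gT : finGroupType) (T : {set gT}) (C : {set {set gT}}).
Local Open Scope group_scope.

(** A walk of at most [L] steps from [v] stays in the ball where [C] is the coboundary of [dl], so
    its sheet changes telescope. *)
Lemma lifts_locally_coboundary (L i : nat) (v : gT) (dl : pred gT) f :
    (forall w t, t \in T -> w \in v *: (1 |: T) ^+ L -> w * t \in v *: (1 |: T) ^+ L ->
       ([set w; w * t] \in C) = dl w (+) dl (w * t)) ->
    i <= L -> f \in lifts T C ^+ i ->
  base f \in (1 |: T) ^+ i /\
  forall b, f (v, b) = (v * base f, b (+) (dl v (+) dl (v * base f))).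
Proof.
move=> loc; elim: i f => [|i IHi] f.
  move=> _ /set1P->; rewrite base1 inE; split=> // b.
  by rewrite perm1 mulg1 addbb addbF.
move=> ltiL; rewrite expgSr => /mulsgP[g h Xg Xh ->].
have [Bg Eg] := IHi _ (ltnW ltiL) Xg.
have Cg := subsetP (expsg_lifts_cover T C i) _ Xg.
have Ch := subsetP (lifts_cover T C) _ Xh.
have ->: base (g * h) = base g * base h by apply: base_morphM Cg Ch.
have Bh : base h \in 1 |: T.
  move: Xh; rewrite 2!inE => /orP[/eqP->|/imsetP[t Tt ->]]; first by rewrite base1 setU11.
  by rewrite base_lift setU1r.
split=> [|b]; first by apply: mem_expsgS.
rewrite permM Eg; move: Xh; rewrite 2!inE => /orP[/eqP->|/imsetP[t Tt ->]].
  by rewrite perm1 base1 mulg1.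
rewrite liftE base_lift loc // ?mulgA ?mem_lcoset ?mulgA ?mulVg ?mul1g.
- by congr (_, _); rewrite -!addbA addKb.
- exact: (subsetP (expsg_homo (setU11 _ _) (ltnW ltiL))).
apply: (subsetP (expsg_homo (setU11 _ _) ltiL)); apply: mem_expsgS => //.
by rewrite setU1r.
Qed.

End LocalCover.

(** * Edge cuts of the Cayley graph and their components for nearness *)

Section CayleyCuts.
Variables (gT : finGroupType) (S : {set gT}).
Implicit Types (D e : {set gT}) (A : {set {set gT}}).
Local Open Scope group_scope.

Local Notation T := (cay_gens S).
Local Notation E := (cay_edges S).
Local Notation ball := (1 |: T).

Lemma cay_gensV t : t \in T -> t^-1 \in T.
Proof.
rewrite !inE eq_invg1 => /andP[-> /orP[St|/imsetP[u Su ->]]]; last by rewrite invgK Su.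
by rewrite imset_f ?orbT.
Qed.

Lemma gen_cay_gens : <<S>> = [set: gT] -> <<T>> = [set: gT].
Proof.
move=> genS; apply/eqP; rewrite eqEsubset subsetT -genS gen_subG.
apply/subsetP=> x Sx; have [->|x1] := eqVneq x 1; first exact: group1.
by rewrite mem_gen // !inE x1 Sx.
Qed.

Lemma cay_edge v t : t \in T -> [set v; v * t] \in E.
Proof. by move=> Tt; apply/imset2P; exists v t; rewrite ?in_setT. Qed.

Lemma cay_edgeP e : e \in E -> exists v t, t \in T /\ e = [set v; v * t].
Proof. by case/imset2P=> v t _ Tt ->; exists v, t. Qed.

Lemma card_cay_edge e : e \in E -> #|e| <= 2.
Proof. by case/cay_edgeP=> v [t [_ ->]]; rewrite cards2; case: (_ != _). Qed.

Lemma card_cay_gens : #|T| <= 2 * #|S|.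
Proof.
apply: leq_trans (subset_leq_card (subsetDl _ _)) _.
apply: leq_trans (leq_card_setU _ _).1 _.
by rewrite mul2n -addnn leq_add2l leq_imset_card.
Qed.

Lemma card_ball i : #|ball ^+ i| <= (2 * #|S|).+1 ^ i.
Proof.
apply: leq_trans (card_expsg _ _) _; case: i => // i; rewrite leq_exp2r //.
by rewrite cardsU1; have := card_cay_gens; case: (_ \notin _); lia.
Qed.

Lemma card_cay_edges : #|E| <= #|gT| * (2 * #|S|).
Proof.
apply: leq_trans (leq_mul (leqnn _) card_cay_gens).
rewrite -cardsT -cardsX.
apply: leq_trans (leq_imset_card (fun u => [set u.1; u.1 * u.2]) _).
apply/subset_leq_card/subsetP=> e /cay_edgeP[v [t [Tt ->]]].
by apply/imsetP; exists (v, t); rewrite // in_setX in_setT.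
Qed.

Lemma adj_in_edge x y : adj_in E x y -> exists2 t, t \in T & y = x * t.
Proof.
move/cay_edgeP=> [v [t [Tt e]]].
have t1 : (t == 1) = false by apply/negbTE; move: Tt; rewrite !inE => /andP[].
have nvt : (v * t == v) = false by rewrite -{2}[v]mulg1 (inj_eq (mulgI v)).
have vx : v \in [set x; y] by rewrite e set21.
have vtx : v * t \in [set x; y] by rewrite e set22.
case/set2P: vx vtx => <- /set2P[] vte.
- by rewrite vte eqxx in nvt.
- by exists t.
- by exists t^-1; rewrite ?cay_gensV // -vte mulgK.
- by rewrite vte eqxx in nvt.
Qed.

Definition cut D : {set {set gT}} :=
  [set e in E | [exists v in e, exists w in e, (v \in D) (+) (w \in D)]].

Lemma cut_edge D v t : t \in T -> ([set v; v * t] \in cut D) = (v \in D) (+) (v * t \in D).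
Proof.
move=> Tt; rewrite inE cay_edge //=; apply/idP/idP.
  case/exists_inP=> a /set2P aE /exists_inP[b /set2P bE].
  by case: aE => ->; case: bE => ->; rewrite ?addbb // addbC.
move=> dD; apply/exists_inP; exists v; first by rewrite set21.
by apply/exists_inP; exists (v * t); first by rewrite set22.
Qed.

Lemma cut_sub D : cut D \subset E.
Proof. by apply/subsetP=> e; rewrite inE => /andP[]. Qed.

Lemma eq_edge_set (A B : {set {set gT}}) : A \subset E -> B \subset E ->
  (forall v t, t \in T -> ([set v; v * t] \in A) = ([set v; v * t] \in B)) -> A = B.
Proof.
move=> sA sB AB; apply/setP=> e; have [/cay_edgeP[v [t [Tt ->]]]|nE] := boolP (e \in E).
  exact: AB.
by rewrite (contraNF (subsetP sA e) nE) (contraNF (subsetP sB e) nE).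
Qed.

Lemma cutC D : cut (~: D) = cut D.
Proof.
apply: eq_edge_set => [||v t Tt]; rewrite ?cut_sub // !cut_edge // !inE.
by case: (_ \in D); case: (_ \in D).
Qed.

Definition near L e e' := [exists v, (e \subset v *: ball ^+ L) && (e' \subset v *: ball ^+ L)].

Lemma near_sym L : symmetric (near L).
Proof. by move=> e e'; apply: eq_existsb => v; rewrite andbC. Qed.

Lemma near_refl L e : 0 < L -> e \in E -> near L e e.
Proof.
move=> L0 /cay_edgeP[v [t [Tt ->]]]; apply/existsP; exists v; rewrite andbb.
apply: subset_trans (mulgS _ (expsg_homo (setU11 _ _) L0)).
rewrite expg1; apply/subsetP=> w /set2P[]->; rewrite mem_lcoset ?mulVg ?setU11 //.
by rewrite mulKg setU1r.
Qed.

Definition edge_conn L A e e' :=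
  connect (fun a b => (b \in A) && near L a b) e e'.

Definition edge_comp L A e := [set e' in A | edge_conn L A e e'].

Lemma edge_comp_conn L A e e' : e \in A -> e' \in edge_comp L A e ->
  edge_conn L (edge_comp L A e) e e'.
Proof.
move=> Ae; rewrite inE => /andP[_ /connectP[p pP ->]].
elim/last_ind: p pP => [_|p b IHp]; first exact: connect0.
rewrite rcons_path last_rcons => /andP[pP /andP[Ab lb]].
apply: connect_trans (IHp pP) (connect1 _); rewrite lb andbT inE Ab /=.
apply: connect_trans (_ : edge_conn L A e (last e p)) (connect1 _); last by rewrite Ab.
by apply/connectP; exists p.
Qed.

Lemma edge_comp_near L A e a b : a \in edge_comp L A e -> b \in A -> near L a b ->
  b \in edge_comp L A e.
Proof.
rewrite !inE => /andP[_ ea] Ab ab; rewrite Ab /=; apply: connect_trans ea (connect1 _).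
by rewrite Ab.
Qed.

(** Edges in a common ball of radius [L] are near, so in a ball containing an edge of [C] the edges
    of [C] are those of the cut. In every ball [C] is thus the coboundary of [D] or of the empty
    set, which [dl] encodes. *)
Lemma edge_comp_locally_closed L D e f :
  f \in lifts T (edge_comp L (cut D) e) ^+ L -> base f = 1 -> f = 1.
Proof.
set C := edge_comp _ _ _ => Xf bf; apply/permP=> -[v b]; rewrite perm1.
have sC : C \subset cut D by apply/subsetP=> a; rewrite inE => /andP[].
pose dl w := [exists a in C, a \subset v *: ball ^+ L] && (w \in D).
have [|||_ ->] := @lifts_locally_coboundary _ T C L L v dl f; rewrite ?bf //; last first.
  by rewrite mulg1 addbb addbF.
move=> w t Tt Bw Bwt; rewrite /dl.
have sub : [set w; w * t] \subset v *: ball ^+ L.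
  by apply/subsetP=> u /set2P[]->.
case: (boolP [exists a in C, _]) => [/exists_inP[a Ca sa] | no] /=; last first.
  apply/negbTE; apply: contra no => Cw.
  by apply/exists_inP; exists [set w; w * t].
rewrite -cut_edge //; apply/idP/idP; first exact: (subsetP sC).
move=> Dw; apply: edge_comp_near Ca Dw _.
by apply/existsP; exists v; rewrite sa.
Qed.

Definition addset D D' := [set v | (v \in D) (+) (v \in D')].

Lemma cut_addset D D' : cut (addset D D') = (cut D :\: cut D') :|: (cut D' :\: cut D).
Proof.
apply: eq_edge_set => [||v t Tt]; rewrite ?cut_sub //.
  by rewrite subUset !(subset_trans (subsetDl _ _)) ?cut_sub.
rewrite in_setU !in_setD !cut_edge // !inE.
by case: (v \in D); case: (v \in D'); case: (v * t \in D); case: (v * t \in D').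
Qed.

(** * Minimal cuts and the size of their components *)

Section Dichotomy.
Variables (H : {group gT}) (s d : nat).
Hypotheses (genS : <<S>> = [set: gT]) (diamS : [set: gT] \subset ball ^+ d).
Hypothesis nilH : 'L_s.+1(H) = 1.

Let n := #|[set: gT] : H|.
(** An upper bound for the length of weight [s + 1] commutators in Schreier generators of length at
    most [(n + n).+1]. *)
Definition loop_length := (2 ^ s * (3 * (n + n).+1))%N.
Local Notation L := loop_length.

(** The bound supplied by a nontrivial cover; [0 < s] is recorded so that one power of the logarithm
    can later be split off. *)
Definition large_size m := (0 < s) &&
  (#|H| <= 2 * (2 ^ s * ((d + d).+1 + ((n + n).+1 + (n + n).+1))) * m).

Lemma component_dichotomy D e : e \in cut D ->
  large_size #|edge_comp L (cut D) e| \/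
  exists D', edge_comp L (cut D) e = cut D'.
Proof.
set C := edge_comp _ _ _ => De.
have sC : C \subset E.
  by apply: subset_trans (cut_sub D); apply/subsetP=> a; rewrite inE => /andP[].
case: (boolP [exists f in <<lifts T C>>, (base f == 1) && (f != 1)]).
  case/exists_inP=> f Nf /andP[/eqP bf f1]; left; apply/andP.
  apply: (large_of_nontrivial_cover cay_gensV _ (gen_cay_gens genS) diamS (erefl n) nilH).
  - by move=> a /(subsetP sC)/card_cay_edge.
  - exact: edge_comp_locally_closed.
  - by exists f.
rewrite negb_exists_in => /forall_inP triv; right.
have [|D' D'P] := coboundary_of_trivial_cover (C := C) (gen_cay_gens genS).
  by move=> f Nf bf; have := triv _ Nf; rewrite bf eqxx negbK => /eqP.
by exists D'; apply: eq_edge_set => [||v t Tt]; rewrite ?cut_sub // D'P // cut_edge.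
Qed.

(** If a component is the cut of [D'], then either [D'] or its complement separates [x] from [y], or
    the symmetric difference of [D] with [D'] (or with its complement) still does. The latter would
    remove the component from the cut, against minimality. *)
Lemma minimal_cut (A : {set {set gT}}) x y D0 :
    x \in D0 -> y \notin D0 -> cut D0 \subset A ->
  exists D, [/\ x \in D, y \notin D, cut D \subset A &
    forall e, e \in cut D ->
      large_size #|edge_comp L (cut D) e| \/ edge_comp L (cut D) e = cut D].
Proof.
move=> D0x D0y sD0.
pose P D := [&& x \in D, y \notin D & cut D \subset A].
have PD0 : P D0 by rewrite /P D0x D0y.
case: (arg_minnP (fun D => #|cut D|) PD0) => D /and3P[Dx Dy sD] minD.
exists D; split=> // e De; have [|[D' eD']] := component_dichotomy De; [by left | right].
have sC : edge_comp L (cut D) e \subset cut D by apply/subsetP=> a; rewrite inE => /andP[].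
apply/eqP; rewrite eqEcard sC /=.
have [{}D' [{}eD' D'x]]: exists D', edge_comp L (cut D) e = cut D' /\ x \notin D'.
  have [D'x|D'x] := boolP (x \in D'); last by exists D'.
  by exists (~: D'); rewrite cutC inE negbK.
rewrite eD' in sC *.
have Ce : e \in cut D' by rewrite -eD' inE De; exact: connect0.
have [D'y|D'y] := boolP (y \in D').
  by rewrite -(cutC D'); apply: minD; rewrite /P cutC !inE D'x D'y (subset_trans sC).
have e2 : cut (addset D D') = cut D :\: cut D'.
  by rewrite cut_addset -[RHS]setU0; congr (_ :|: _); apply/eqP; rewrite setD_eq0.
have := minD (addset D D'); rewrite e2 /P !inE Dx (negPf Dy) (negPf D'x) (negPf D'y) e2.
rewrite (subset_trans (subsetDl _ _)) // => /(_ isT) le.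
have: #|cut D :\: cut D'| < #|cut D|.
  by apply/proper_card/properP; split; [exact: subsetDl | exists e; rewrite // inE Ce].
by rewrite ltnNge le.
Qed.

End Dichotomy.

Lemma closed_gens_full (Q : {set gT}) u : <<S>> = [set: gT] -> u \in Q ->
  (forall v t, v \in Q -> t \in T -> v * t \in Q) -> Q = [set: gT].
Proof.
move=> genS Qu clQ; apply/setP=> w; rewrite inE.
have: u^-1 * w \in <<T>> by rewrite gen_cay_gens ?inE.
case/gen_prodgP=> m [c Tc e].
have ->: w = u * \prod_(i < m) c i by rewrite -e mulKVg.
elim: m c Tc {e} => [|m IHm] c Tc; first by rewrite big_ord0 mulg1.
by rewrite big_ord_recr mulgA; apply: clQ (Tc _); apply: IHm => i; apply: Tc.
Qed.

(** * Translates of a connected cut *)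

Section Translates.
Variables (L : nat) (D : {set gT}) (e0 : {set gT}).
Hypotheses (genS : <<S>> = [set: gT]) (L_gt0 : 0 < L).
Hypothesis De0 : e0 \in cut D.
Hypothesis conn : forall e, e \in cut D -> edge_conn L (cut D) e0 e.

Definition apart g :=
  [forall e in cut D, forall e' in cut D, ~~ near L e (g *: e')].

Lemma near_translate g e e' : near L (g *: e) (g *: e') = near L e e'.
Proof.
suff imp h a b : near L a b -> near L (h *: a) (h *: b).
  by apply/idP/idP => [/(imp g^-1)|]; [rewrite -!lcosetM mulVg !lcoset1 | exact: imp].
case/existsP=> v /andP[sa sb]; apply/existsP; exists (h * v).
by rewrite !lcosetM !mulgS.
Qed.

Lemma apartV g : apart g -> apart g^-1.
Proof.
move/forall_inP=> ap; apply/forall_inP=> e De; apply/forall_inP=> e' De'.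
by rewrite -(near_translate g) near_sym -lcosetM mulgV lcoset1 (forall_inP (ap _ De')).
Qed.

(** In a ball of radius [L] containing an edge of the cut, membership in [g *: D] is constant, or an
    edge of the translated cut would be near. Connectedness carries the value from ball to ball. *)
Lemma same_side g : apart g ->
  exists b, forall e a, e \in cut D -> a \in e -> (g^-1 * a \in D) = b.
Proof.
move/forall_inP=> ap.
have flat e v a : e \in cut D -> e \subset v *: ball ^+ L -> a \in v *: ball ^+ L ->
    (g^-1 * a \in D) = (g^-1 * v \in D).
  move=> De sev /lcosetP[w Bw ->].
  have: exists2 i, i <= L & w \in ball ^+ i by exists L.
  case=> i; elim: i w {Bw} => [|i IHi] w; first by move=> _ /set1P->; rewrite mulg1.
  move=> ltiL; rewrite expgSr => /mulsgP[u t Bu Bt ->].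
  rewrite -(IHi u (ltnW ltiL) Bu); apply/eqP/negPn/negP=> ne.
  have Tt : t \in T.
    by move: Bt ne; rewrite in_setU1 => /orP[/eqP->|//]; rewrite mulg1 eqxx.
  have Cut : [set g^-1 * (v * u); g^-1 * (v * u) * t] \in cut D.
    by rewrite cut_edge // -!mulgA; move: ne; case: (_ \in D); case: (_ \in D).
  have /negP[] := forall_inP (ap _ De) _ Cut; apply/existsP; exists v; rewrite sev /=.
  have sB j z : j <= L -> z \in ball ^+ j -> v * z \in v *: ball ^+ L.
    by move=> jL Bz; rewrite mem_lcoset mulKg (subsetP (expsg_homo (setU11 _ _) jL)).
  apply/subsetP=> _ /lcosetP[z /set2P[]-> ->]; rewrite !mulgA mulgV mul1g -?mulgA.
    exact: (sB i _ (ltnW ltiL)).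
  by apply: (sB i.+1) => //; apply: mem_expsgS.
have flat2 e e' a a' : e \in cut D -> e' \in cut D -> near L e e' -> a \in e -> a' \in e' ->
    (g^-1 * a' \in D) = (g^-1 * a \in D).
  move=> De De' /existsP[v /andP[s1 s2]] ea ea'.
  by rewrite (flat _ _ _ De s1 (subsetP s1 _ ea)) (flat _ _ _ De s1 (subsetP s2 _ ea')).
have [v0 [t0 [_ e0E]]] := cay_edgeP (subsetP (cut_sub D) _ De0).
exists (g^-1 * v0 \in D) => e a De ea.
have /connectP[p pP el] := conn De; move: De ea; rewrite {e}el.
elim/last_ind: p a pP => [|p b IHp] a.
  move=> _ _; rewrite /= => e0a; apply: (flat2 e0 e0) => //.
    by rewrite near_refl // (subsetP (cut_sub D)).
  by rewrite e0E set21.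
rewrite rcons_path last_rcons => /andP[pP /andP[_ nb]] Db ba.
have Dl : last e0 p \in cut D.
  case/lastP: p pP {nb IHp} => // p c; rewrite rcons_path last_rcons.
  by case/andP=> _ /andP[].
have [v [t [_ lE]]] := cay_edgeP (subsetP (cut_sub D) _ Dl).
have lv : v \in last e0 p by rewrite lE set21.
by rewrite (flat2 _ _ v a Dl Db nb lv ba) (IHp v).
Qed.

(** The corner [Q], an intersection of [D] or its complement with [g *: D] or its complement, is
    closed under adjacency and lies on one side of [D], so it is empty. By cardinality, three of the
    four corners would force [g *: D] to be [D] or its complement; the fourth gives disjointness. *)
Lemma apart_disjoint g x y : x \in D -> y \notin D -> 2 * #|D| <= #|gT| -> apart g ->
  forall u, u \in D -> g * u \notin D.
Proof.
move=> Dx Dy le2 ap.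
have [b1 side1] := same_side ap; have [b2 side2] := same_side (apartV ap).
pose Q := [set u | ((u \in D) == ~~ b2) && ((g^-1 * u \in D) == ~~ b1)].
have clQ u t : u \in Q -> t \in T -> u * t \in Q.
  move=> + Tt; rewrite !inE => /andP[/eqP Du /eqP Dgu].
  have ->: (u * t \in D) = (u \in D).
    apply/eqP/negPn/negP=> ne; have Cut : [set u; u * t] \in cut D.
      by rewrite cut_edge //; move: ne; case: (_ \in D); case: (_ \in D).
    by have := side1 _ u Cut (set21 _ _); rewrite Dgu; case: (b1).
  have ->: (g^-1 * (u * t) \in D) = (g^-1 * u \in D).
    apply/eqP/negPn/negP=> ne; have Cut : [set g^-1 * u; g^-1 * u * t] \in cut D.
      by rewrite cut_edge // -mulgA; move: ne; case: (_ \in D); case: (_ \in D).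
    by have := side2 _ _ Cut (set21 _ _); rewrite invgK mulKVg Du; case: (b2).
  by rewrite Du Dgu !eqxx.
have Q0 u : u \notin Q.
  apply/negP=> Qu; have QT := closed_gens_full genS Qu clQ.
  have /[!inE] /andP[/eqP] : x \in Q by rewrite QT inE.
  have /[!inE] /andP[/eqP] : y \in Q by rewrite QT inE.
  by rewrite Dx (negPf Dy) => <-.
have [v0 [t0 [Tt0 e0E]]] := cay_edgeP (subsetP (cut_sub D) _ De0).
have Dv0 : (v0 \in D) (+) (v0 * t0 \in D) by rewrite -cut_edge // -e0E.
have s1 := side1 _ v0 De0; have s2 := side1 _ (v0 * t0) De0.
rewrite e0E set21 in s1; rewrite e0E set22 in s2.
(* The ends of [e0] lie on the same side of [g *: D] but on opposite sides of [D]. *)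
have {s1 s2} neq : ~ (forall u, (g^-1 * u \in D) = (u \in D)) /\
                   ~ (forall u, (g^-1 * u \in D) = (u \notin D)).
  split=> eqD; move: Dv0 (s1 isT) (s2 isT); rewrite !eqD;
  by case: (_ \in D); case: (_ \in D) => //= _ <-.
have inlc u : (u \in g *: D) = (g^-1 * u \in D) by rewrite mem_lcoset.
have cl := card_lcoset D g.
have cC : #|~: D| + #|D| = #|gT| by rewrite addnC cardsC.
case: b1 b2 {side1 side2 clQ} @Q Q0 => -[] Q Q0 u Du; last 1 first.
- by have := Q0 (g * u); rewrite !inE mulKg Du /= andbT; case: (_ \in D).
- case: neq => _ []; suff /setP eqD : ~: D = g *: D.
    by move=> w; have := eqD w; rewrite !inE inlc => ->.
  apply/eqP; rewrite eqEcard cl; apply/andP; split; last by move: cC le2; clear; lia.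
  apply/subsetP=> w; rewrite inE inlc => Dw; have := Q0 w; rewrite !inE (negPf Dw) /=.
  by case: (_ \in D).
- case: neq => [] []; suff /setP eqD : D = g *: D.
    by move=> w; have := eqD w; rewrite inlc => ->.
  apply/eqP; rewrite eqEcard cl leqnn andbT.
  apply/subsetP=> w; rewrite inlc => Dw; have := Q0 w; rewrite !inE Dw /=.
  by case: (_ \in D).
case: neq => [] []; suff /setP eqD : g *: D = D.
  by move=> w; have := eqD w; rewrite inlc => ->.
apply/eqP; rewrite eqEcard cl leqnn andbT.
apply/subsetP=> w; rewrite inlc => Dw; have := Q0 w; rewrite !inE Dw /= andbT.
by case: (_ \in D).
Qed.

(* Every translation carrying a point of [D] to a point of [D] must move the cut close to itself. *)
Lemma card_small_side x y : x \in D -> y \notin D -> 2 * #|D| <= #|gT| ->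
  #|D| <= #|cut D| ^ 2 * #|ball ^+ (L + L)|.
Proof.
move=> Dx Dy le2; pose r (e : {set gT}) := odflt 1 [pick v in e].
have rP e : e \in cut D -> r e \in e.
  move/(subsetP (cut_sub D))/cay_edgeP=> [v [t [_ ->]]]; rewrite /r.
  by case: pickP => //= /(_ v); rewrite set21.
(* If [z * x^-1] moves [e'] near [e], then [z] is recovered from [e], [e'] and the displacement, in
   [ball ^+ (L + L)], between chosen endpoints. *)
pose f (q : {set gT} * {set gT} * gT) := r q.1.1 * q.2 * (r q.1.2)^-1 * x.
rewrite -mulnn -!cardsX; apply: leq_trans (leq_imset_card f _).
apply/subset_leq_card/subsetP=> z Dz.
have: ~~ apart (z * x^-1).
  apply: contraL Dz => ap; have := apart_disjoint Dx Dy le2 ap Dx.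
  by rewrite mulgKV.
rewrite negb_forall_in => /exists_inP[e De]; rewrite negb_forall_in => /exists_inP[e' De'].
rewrite negbK => /existsP[v /andP[s1 s2]].
have /lcosetP[b Bb eb] := subsetP s1 _ (rP _ De).
have gr : z * x^-1 * r e' \in z * x^-1 *: e' by rewrite mem_lcoset mulKg rP.
have /lcosetP[b' Bb' eb'] := subsetP s2 _ gr.
apply/imsetP; exists (e, e', b^-1 * b').
  rewrite !in_setX De De' /=; apply: mem_expsgD Bb'; apply: mem_expsgV Bb => u.
  exact: (ballV cay_gensV).
by rewrite /f /= eb !mulgA mulgK -eb' mulgK mulgKV.
Qed.

End Translates.

(** * Distances, paths and the first crossing of a cut *)

Lemma cay_connected x y : <<S>> = [set: gT] -> connect (adj_in E) x y.
Proof.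
move=> genS; pose Q := [set v | connect (adj_in E) x v].
have QT : Q = [set: gT].
  apply: (@closed_gens_full Q x) => //; first by rewrite inE connect0.
  move=> v t + Tt; rewrite !inE => xv.
  by apply: connect_trans xv (connect1 _); apply: cay_edge.
by have := in_setT y; rewrite -QT inE.
Qed.

Lemma within_ball m x y : within E m x y -> x^-1 * y \in ball ^+ m.
Proof.
elim: m y => [|m IHm] y /=; first by move/eqP->; rewrite mulVg inE.
case/orP=> [/IHm|/existsP[z /andP[/IHm xz /adj_in_edge[t Tt ->]]]].
  exact: (subsetP (expsg_homo (setU11 _ _) (leqnSn m))).
by rewrite mulgA mem_expsgS // setU1r.
Qed.

Lemma cay_diam_ball : <<S>> = [set: gT] -> [set: gT] \subset ball ^+ cay_diam S.
Proof.
move=> genS; apply/subsetP=> g _.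
have le: cay_dist S 1 g <= cay_diam S.
  apply: leq_trans (leq_bigmax_cond (F := fun x => \max_y cay_dist S x y) 1 isT).
  exact: (leq_bigmax_cond (F := cay_dist S 1) g isT).
apply: (subsetP (expsg_homo (setU11 _ _) le)); rewrite /cay_dist.
set P := fun m => _; have [hasP|noP] := boolP (has P (iota 0 #|gT|)).
  have lt : find P (iota 0 #|gT|) < #|gT|.
    by rewrite -[X in _ < X](size_iota 0) -has_find.
  have := nth_find 0 hasP; rewrite nth_iota // add0n => /within_ball.
  by rewrite invg1 mul1g.
(* Here [cay_dist] has its default value [#|gT|], and [ball ^+ #|gT|] is already the whole group. *)
rewrite (hasNfind noP) size_iota.
have := @gen_sub_mul_expsg _ ball 1%G #|gT| (setU11 _ _) (sub1G _).
by rewrite (gen_ball (gen_cay_gens genS)) mul1g indexg1 cardsT => /(_ (leqnn _))/subsetP->; rewrite ?inE.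
Qed.

(** Past the end of the path the default [x] fills in, so a list of first edges can be formed
    whatever the length of [p]. *)
Definition edge_at x p i : {set gT} := [set nth x (x :: p) i; nth x (x :: p) i.+1].

(** The first vertex outside [D] has index [i + 1], and the [i + 1] vertices before it are distinct
    and lie in [D]. *)
Lemma cut_crossing D x p : path (adj_in E) x p -> uniq (x :: p) ->
  x \in D -> last x p \notin D -> exists2 i, i < #|D| & edge_at x p i \in cut D.
Proof.
move=> pP up Dx Dl.
have hs : has [predC D] (x :: p) by apply/hasP; exists (last x p); rewrite ?mem_last.
have := nth_find x hs; have fs := hs; rewrite has_find in fs.
case fE: (find _ _) fs => [|i] fs; first by rewrite /= Dx.
move=> /= Di1; have bf j : j <= i -> nth x (x :: p) j \in D.
  move=> leji; apply/negPn; have := before_find (a := [predC D]) (s := x :: p) x (i := j).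
  by rewrite fE ltnS => /(_ leji) /= ->.
exists i; last first.
  have := pathP x pP i; rewrite -ltnS => /(_ fs) /adj_in_edge[t Tt e].
  by rewrite /edge_at /= e cut_edge // -e (negPf Di1) bf.
have st : size (take i.+1 (x :: p)) = i.+1 by rewrite size_take fs.
rewrite -st cardE; apply: uniq_leq_size (take_uniq _ up) _ => v; rewrite mem_enum => /(nthP x)[j].
by rewrite st => ltj <-; rewrite nth_take ?bf.
Qed.

(** * Closed connected edge sets with few possible roots *)

Section ClosedAnimal.
Variables (H : {group gT}) (s d : nat).
Hypotheses (genS : <<S>> = [set: gT]) (diamS : [set: gT] \subset ball ^+ d).
Hypothesis nilH : 'L_s.+1(H) = 1.
Local Notation L := (loop_length H s).

Lemma small_cut_edge D e x p : x \in D -> last x p \notin D ->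
    path (adj_in E) x p -> uniq (x :: p) -> 2 * #|D| <= #|gT| ->
    e \in cut D -> edge_comp L (cut D) e = cut D ->
  exists2 i, i < #|cut D| ^ 2 * #|ball ^+ (L + L)| & edge_at x p i \in cut D.
Proof.
move=> Dx Dl pP up le2 De eD.
have [i ltiD Di] := cut_crossing pP up Dx Dl; exists i => //.
apply: leq_trans ltiD _; apply: (card_small_side genS _ De) Dx Dl le2.
  by rewrite !muln_gt0 expn_gt0.
by move=> a; rewrite -{1}eD inE => /andP[].
Qed.

(** The possible roots [e] depend only on [#|C|] and the two fixed paths, as a union bound
    requires. *)
Definition rooted_animal (w : {set {set gT}}) x p y p' (C : {set {set gT}}) e : Prop :=
  [/\ e \in C, C \subset E, [disjoint C & w],
    forall e', e' \in C -> edge_conn L C e e' &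
    large_size H s d #|C| \/
    exists2 i, i < #|C| ^ 2 * #|ball ^+ (L + L)| & e = edge_at x p i \/ e = edge_at y p' i].

Lemma closed_animal (w : {set {set gT}}) x y p p' :
    path (adj_in E) x p -> uniq (x :: p) -> last x p = y ->
    path (adj_in E) y p' -> uniq (y :: p') -> last y p' = x ->
    ~~ connect (adj_in w) x y ->
  exists C e, rooted_animal w x p y p' C e.
Proof.
move=> pP up lp pP' up' lp' nxy.
pose D0 := [set v | connect (adj_in w) x v].
have D0x : x \in D0 by rewrite inE connect0.
have D0y : y \notin D0 by rewrite inE.
(* An open edge has both ends in the cluster of [x] or neither. *)
have sD0 : cut D0 \subset E :\: w.
  apply/subsetP=> e De; have Ee := subsetP (cut_sub _) _ De.
  rewrite inE Ee andbT; apply/negP=> we.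
  case/cay_edgeP: Ee De we => v [t [Tt ->]]; rewrite cut_edge // !inE => + we.
  have ->: connect (adj_in w) x (v * t) = connect (adj_in w) x v; last by rewrite addbb.
  by apply/idP/idP=> xv; apply: connect_trans xv (connect1 _); rewrite /adj_in // setUC.
have [D [Dx Dy sD alt]] := minimal_cut genS diamS nilH D0x D0y sD0.
have sDE : cut D \subset E := cut_sub D.
have dis : forall C : {set {set gT}}, C \subset cut D -> [disjoint C & w].
  move=> C sC; apply/pred0P=> e /=; apply/negP=> /andP[/(subsetP sC)/(subsetP sD)].
  by rewrite inE => /andP[/negPf->].
have big e : e \in cut D -> large_size H s d #|edge_comp L (cut D) e| ->
    exists C e, rooted_animal w x p y p' C e.
  move=> De lg; have sC : edge_comp L (cut D) e \subset cut D.
    by apply/subsetP=> a; rewrite inE => /andP[].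
  exists (edge_comp L (cut D) e), e; split; [|exact: subset_trans sC sDE|exact: dis| |by left].
  - by rewrite inE De; exact: connect0.
  - by move=> e'; apply: edge_comp_conn.
have Dlp : last x p \notin D by rewrite lp.
have [i0 _ De0] := cut_crossing pP up Dx Dlp.
have [/(big _ De0)//|eD0] := alt _ De0.
have fin e : e \in cut D ->
    (exists2 i, i < #|cut D| ^ 2 * #|ball ^+ (L + L)| & e = edge_at x p i \/ e = edge_at y p' i) ->
    exists C e, rooted_animal w x p y p' C e.
  move=> De iP; have [/(big _ De)//|eD] := alt _ De.
  exists (cut D), e; split=> //; [exact: dis | | by right].
  by move=> e'; rewrite -{1}eD inE => /andP[].
(* The smaller side is used: [D] with the path from [x], or its complement with the path from
   [y]. *)
have [le2|lt2] := leqP (2 * #|D|) #|gT|.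
  have [i lti Di] := small_cut_edge Dx Dlp pP up le2 De0 eD0.
  by apply: (fin _ Di); exists i => //; left.
have le2 : 2 * #|~: D| <= #|gT|.
  by move: lt2; rewrite -(cardsC D) !mul2n -!addnn ltn_add2l leq_add2r; exact: ltnW.
have Cy : y \in ~: D by rewrite inE.
have Cx : last y p' \notin ~: D by rewrite lp' inE negbK.
have := small_cut_edge Cy Cx pP' up' le2 (e := edge_at x p i0); rewrite cutC.
case/(_ De0 eD0)=> i lti Di.
by apply: (fin _ Di); exists i => //; right.
Qed.

End ClosedAnimal.

Definition edge_step L (a b : {set gT}) := [&& a \in E, b \in E & near L a b].

(** An edge near [a] is determined by the displacements of its two ends from one end of [a]. *)
Lemma card_edge_step L a : #|edge_step L a| <= #|ball ^+ (L + L)| ^ 2.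
Proof.
have [Ea|nEa] := boolP (a \in E); last first.
  rewrite (_ : #|edge_step L a| = 0) //; apply: eq_card0 => b.
  by rewrite unfold_in /edge_step (negPf nEa).
have [v [t [_ aE]]] := cay_edgeP Ea.
pose f (q : gT * gT) := [set v * q.1; v * q.2].
rewrite -mulnn -cardsX; apply: leq_trans (leq_imset_card f _).
apply/subset_leq_card/subsetP=> b; rewrite unfold_in => /and3P[_ Eb].
case/existsP=> z /andP[s1 s2].
have [c [u [_ bE]]] := cay_edgeP Eb.
have /lcosetP[r Br vE] : v \in z *: ball ^+ L by rewrite (subsetP s1) // aE set21.
have /lcosetP[r1 Br1 cE] : c \in z *: ball ^+ L by rewrite (subsetP s2) // bE set21.
have /lcosetP[r2 Br2 cuE] : c * u \in z *: ball ^+ L by rewrite (subsetP s2) // bE set22.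
have BV : r^-1 \in ball ^+ L by apply: mem_expsgV Br => q; apply: (ballV cay_gensV).
apply/imsetP; exists (r^-1 * r1, r^-1 * r2); first by rewrite in_setX !mem_expsgD.
by rewrite /f /= vE !mulgA !mulgK -cE -cuE.
Qed.

End CayleyCuts.

(** * Coding connected sets by walks *)

Section Walks.
Variables (I : finType) (r : rel I) (N : nat).

(** Steps are coded by ranks in neighbour lists; a rank out of range stays put, so every code can be
    decoded. *)
Fixpoint walk_of (a : I) (c : seq 'I_N) : seq I :=
  if c is i :: c' then
    let b := nth a (enum (r a)) i in b :: walk_of b c'
  else [::].

Lemma walk_ofP a p : (forall b, #|r b| <= N) -> path r a p ->
  exists c : (size p).-tuple 'I_N, walk_of a c = p.
Proof.
move=> degr; elim: p a => [|b p IHp] a /=; first by exists [tuple].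
case/andP=> rab /IHp[c cE].
have lt : index b (enum (r a)) < N.
  by apply: leq_trans (degr a); rewrite cardE index_mem mem_enum.
by exists (cons_tuple (Ordinal lt) c); rewrite //= nth_index ?mem_enum // cE.
Qed.

Lemma exit_edge (C X : {set I}) e f : e \in X -> f \notin X ->
  connect (fun a b => (b \in C) && r a b) e f ->
  exists u v, [/\ u \in X, v \in C, v \notin X & r u v].
Proof.
move=> Xe nXf /connectP[p]; elim: p e Xe => [|b p IHp] e Xe /=.
  by move=> _ fe; rewrite fe Xe in nXf.
case/andP=> /andP[Cb reb] pP lE; have [Xb|nXb] := boolP (b \in X); first exact: IHp Xb _ _.
by exists e, b.
Qed.

(* A depth-first traversal: each new vertex costs a step forth and a step back. *)
Lemma animal_walk (C : {set I}) e : symmetric r -> e \in C ->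
    (forall f, f \in C -> connect (fun a b => (b \in C) && r a b) e f) ->
  exists p, [/\ path r e p, size p = (#|C|.-1).*2 & C = [set a in e :: p]].
Proof.
move=> symr Ce conn.
have C0 : 0 < #|C| by apply/card_gt0P; exists e.
suff grow k : k < #|C| -> exists p, [/\ path r e p, size p = k.*2,
    {subset e :: p <= C} & #|[set a in e :: p]| = k.+1].
  have [|p [pP sp sub cp]] := grow #|C|.-1; first by rewrite ltn_predL.
  exists p; split=> //; apply/esym/eqP; rewrite eqEcard cp prednK // leqnn andbT.
  by apply/subsetP=> a; rewrite inE => /sub.
elim: k => [|k IHk] ltkC.
  exists [::]; split=> // [a|]; first by rewrite inE => /eqP->.
  by rewrite (_ : [set a in [:: e]] = [set e]) ?cards1 //; apply/setP=> a; rewrite !inE.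
have [p [pP sp sub cp]] := IHk (ltnW ltkC).
have [f Cf nXf] : exists2 f, f \in C & f \notin [set a in e :: p].
  apply/subsetPn; apply: contraL ltkC => /subset_leq_card; rewrite cp; lia.
have [|u [v [Xu Cv nXv ruv]]] := exit_edge (X := [set a in e :: p]) _ nXf (conn _ Cf).
  by rewrite inE mem_head.
rewrite inE in Xu; rewrite inE in nXv.
(* A detour to [v] and back, inserted at a visit to [u], adds only [v] to the visited set. *)
have memE (p1 p2 : seq I) : last e p1 = u -> e :: p1 ++ [:: v, u & p2] =i v :: e :: p1 ++ p2.
  move=> lE a; rewrite !(inE, mem_cat); have := mem_last e p1; rewrite lE inE.
  case: (eqVneq a u) => [->|_]; first by case/orP=> ->; rewrite ?orbT.
  by move=> _; case: (a == v); case: (a == e); case: (a \in p1); case: (a \in p2).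
case/splitPl: Xu pP sp sub cp nXv => p1 p2 lE pP sp sub cp nXv.
exists (p1 ++ [:: v, u & p2]); split.
- by move: pP; rewrite !cat_path lE /= ruv symr ruv.
- by move: sp; rewrite !size_cat /=; lia.
- by move=> a; rewrite memE // inE => /orP[/eqP->|/sub].
rewrite (_ : [set a in _] = v |: [set a in e :: p1 ++ p2]); last first.
  by apply/setP=> a; rewrite !inE -!in_cons memE // inE.
by rewrite cardsU1 inE nXv cp.
Qed.

End Walks.

(** * Bernoulli weights and the union bound *)

Section BernoulliSum.
Variables (R : realFieldType) (I : finType) (E : {set I}) (p : R).
Local Open Scope ring_scope.

(** Grouping sets by cardinality gives the binomial expansion of [((1 - p) + p) ^+ #|F|]. *)
Lemma sum_bernoulli (F : {set I}) :
  \sum_(w : {set I} | w \subset F) p ^+ #|w| * (1 - p) ^+ (#|F| - #|w|) = 1.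
Proof.
transitivity (((1 - p) + p) ^+ #|F|); last by rewrite subrK expr1n.
rewrite exprDn (partition_big (fun w : {set I} => inord #|w| : 'I_#|F|.+1) xpredT) //=.
apply: eq_bigr => i _.
rewrite (eq_bigl (mem [set w : {set I} | (w \subset F) & (#|w| == i)])); last first.
  move=> w; rewrite /= inE; apply: andb_id2l => sw.
  by rewrite -val_eqE /= inordK // ltnS subset_leq_card.
rewrite (eq_bigr (fun=> (1 - p) ^+ (#|F| - i) * p ^+ i)); last first.
  by move=> w; rewrite /= inE => /andP[_ /eqP->]; rewrite mulrC.
by rewrite sumr_const cards_draws.
Qed.

Lemma sum_bernoulli_closed (W : {set I}) : W \subset E ->
  \sum_(w : {set I} | (w \subset E) && [disjoint W & w])
     p ^+ #|w| * (1 - p) ^+ (#|E| - #|w|) = (1 - p) ^+ #|W|.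
Proof.
move=> sWE; rewrite (eq_bigl (fun w : {set I} => w \subset E :\: W)); last first.
  by move=> w; rewrite subsetD disjoint_sym.
rewrite -[RHS]mulr1 -[X in _ * X](sum_bernoulli (E :\: W)) mulr_sumr; apply: eq_bigr => w sw.
rewrite [RHS]mulrCA -exprD; congr (_ * _ ^+ _).
have := cardsID W E; rewrite (setIidPr sWE); have := subset_leq_card sw; lia.
Qed.

End BernoulliSum.

From mathcomp Require Import reals.

Section UnionBound.
Variables (R : realType) (gT : finGroupType) (S : {set gT}) (p : R).
Variables (L N : nat) (roots : nat -> {set {set gT}}).
Hypotheses (p_ge0 : (0 <= p)%R) (p_le1 : (p <= 1)%R).
Hypothesis deg : forall a, #|edge_step S L a| <= N.
Local Open Scope ring_scope.
Local Notation E := (cay_edges S).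

(** A connected set of [m + 1] edges is visited by a walk of [m.*2] steps from its root, so each
    root accounts for at most [N ^ m.*2] sets, each closed with probability [(1 - p) ^+ m.+1]. *)
Lemma perc_conn_prob_ge x y :
    (forall w : {set {set gT}}, ~~ connect (adj_in w) x y ->
       exists (C : {set {set gT}}) e, [/\ e \in C, C \subset E, [disjoint C & w],
         forall e', e' \in C -> edge_conn S L C e e' & e \in roots #|C|]) ->
  1 - \sum_(m < #|E|) (#|roots m.+1| * N ^ m.*2)%:R * (1 - p) ^+ m.+1 <= perc_conn_prob S p x y.
Proof.
move=> animal.
pose mu (w : {set {set gT}}) := p ^+ #|w| * (1 - p) ^+ (#|E| - #|w|).
have mu0 w : 0 <= mu w by rewrite mulr_ge0 ?exprn_ge0 ?subr_ge0.
pose W m e (c : m.*2.-tuple 'I_N) := [set a in e :: walk_of (edge_step S L) e c].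
(* Codes may revisit edges or leave the graph; [ok] keeps those yielding exactly [m + 1] edges. *)
pose ok m e (c : m.*2.-tuple 'I_N) := (W m e c \subset E) && (#|W m e c| == m.+1).
have split1 : 1 = perc_conn_prob S p x y +
    \sum_(w : {set {set gT}} | (w \subset E) && ~~ connect (adj_in w) x y) mu w.
  rewrite -[LHS](sum_bernoulli p E) (bigID (fun w => connect (adj_in w) x y)) /=; congr (_ + _).
  rewrite /perc_conn_prob [RHS](bigID (fun w => connect (adj_in w) x y)) /=.
  rewrite [X in _ = _ + X]big1 ?addr0; last by move=> w /andP[_ /negPf->]; rewrite mulr0.
  by apply: eq_bigr => w /andP[_ ->]; rewrite mulr1.
rewrite lerBlDr [leLHS]split1 lerD2l.
(* The indicator of disconnection is at most the number of codes whose decoded set is closed. *)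
apply: (@le_trans _ _ (\sum_(w : {set {set gT}} | w \subset E) \sum_(m < #|E|)
   \sum_(e in roots m.+1) \sum_(c : m.*2.-tuple 'I_N | ok m e c) mu w * ([disjoint W m e c & w])%:R)).
  rewrite big_mkcondr /=; apply: ler_sum => w sw.
  have term0 m e c : 0 <= mu w * ([disjoint W m e c & w])%:R by rewrite mulr_ge0.
  case: ifP => [/animal[C [e [Ce sC dis conn rt]]]|_]; last first.
    by do 3 (apply: sumr_ge0 => ? _).
  have C0 : (0 < #|C|)%N by apply/card_gt0P; exists e.
  have [q [qP sq qC]] := animal_walk (@near_sym _ S L) Ce conn.
  have {}qP : path (edge_step S L) e q.
    apply: (sub_in_path (P := mem E)) qP; first by move=> a b Ea Eb nab; apply/and3P.
    by apply/allP=> a aq; apply: (subsetP sC); rewrite qC inE.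
  have [m mE] : exists m : 'I_#|E|, #|C| = m.+1.
    have ltm : (#|C|.-1 < #|E|)%N by rewrite prednK // subset_leq_card.
    by exists (Ordinal ltm); rewrite /= prednK.
  have [c cE] := walk_ofP deg qP.
  have {c cE} [c cE] : exists c : m.*2.-tuple 'I_N, W m e c = C.
    have {}sq : size q = m.*2 by rewrite sq mE.
    by rewrite /W; move: c cE; rewrite sq => c cE; exists c; rewrite cE qC.
  rewrite (bigD1 m) //= (bigD1 e) /=; last by rewrite -mE.
  rewrite [X in _ <= X + _ + _](bigD1 c) /=; last by rewrite /ok cE sC mE /=.
  rewrite cE dis mulr1 -!addrA lerDl !addr_ge0 //.
  - exact: sumr_ge0.
  - by do 2 (apply: sumr_ge0 => ? _).
  - by do 3 (apply: sumr_ge0 => ? _).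
rewrite exchange_big; apply: ler_sum => m _ /=.
rewrite exchange_big /= natrM -mulrA mulr_natl -sumr_const; apply: ler_sum => e _.
rewrite exchange_big /= mulr_natl.
apply: (@le_trans _ _ (\sum_(c : m.*2.-tuple 'I_N) (1 - p) ^+ m.+1)); last first.
  by rewrite sumr_const card_tuple card_ord.
rewrite big_mkcond /=; apply: ler_sum => c _; case: ifP => [/andP[sW /eqP cW]|_]; last first.
  by rewrite exprn_ge0 ?subr_ge0.
rewrite -cW -(sum_bernoulli_closed p sW) big_mkcondr /=.
by apply: ler_sum => w _; case: ifP; rewrite ?mulr1 ?mulr0.
Qed.

End UnionBound.

From mathcomp Require Import all_classical all_reals all_analysis.
Import Order.TTheory GRing.Theory Num.Theory.

(** * From the diameter hypothesis to a logarithmic lower bound *)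

Section LogarithmicBounds.
Variable R : realType.
Local Open Scope ring_scope.

Lemma half_geometric_sum_le1 M : \sum_(m < M) (2^-1 : R) ^+ m.+1 <= 1.
Proof.
have ->: \sum_(m < M) (2^-1 : R) ^+ m.+1 = 1 - 2^-1 ^+ M.
  elim: M => [|M IHM]; first by rewrite big_ord0 expr0 subrr.
  by rewrite big_ord_recr /= IHM exprS; field.
by rewrite gerBl exprn_ge0.
Qed.

Lemma sqrn_le_exp4 m : (m ^ 2 <= 4 ^ m)%N.
Proof. by rewrite -[4%N]/(2 ^ 2)%N -expnM mulnC expnM leq_exp2r // ltnW // ltn_expl. Qed.

(** Since [#|gT| = #|H| * n], largeness bounds [#|gT|] by a constant times [d * m]. Inserting the
    diameter hypothesis bounds the [s]-th power of the logarithm by a multiple of [m], and [s - 1]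
    of its factors are at least [ln 2]. *)
Lemma ln_card_le_large (gT : finGroupType) (H : {group gT}) (S : {set gT}) (s n m : nat) (lam : R) :
    0 < lam -> (2 <= #|gT|)%N -> #|[set: gT] : H|%g = n -> (<<S>> = [set: gT])%g ->
    (cay_diam S)%:R <= lam * (#|gT|)%:R / (ln (#|gT|%:R : R)) ^+ s ->
    large_size H s (cay_diam S) m ->
  ln (#|gT|%:R : R) <= lam * (n * (2 * (2 ^ s * (3 + ((n + n).+1 + (n + n).+1)))))%:R
                         / ln 2 ^+ s.-1 * m%:R.
Proof.
move=> lam0 gT2 iH genS diam; rewrite /large_size iH => /andP[s0 leH].
set d := cay_diam S in diam leH; set c := (n + n).+1 in leH *.
have d0 : (0 < d)%N.
  rewrite lt0n; apply/eqP => d0; have := cay_diam_ball genS; rewrite -/d d0 expg0.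
  by move/subset_leq_card; rewrite finset.cardsT cards1 leqNgt gT2.
set u := (n * _)%N.
have cardG : (#|gT| <= u * d * m)%N.
  have <-: (#|H| * n)%N = #|gT| by rewrite -iH Lagrange ?finset.subsetT // finset.cardsT.
  (* Positivity of [d] absorbs the additive constants. *)
  have le3 : ((d + d).+1 + (c + c) <= (3 + (c + c)) * d)%N by move: d0; clear; nia.
  rewrite mulnC /u; apply: leq_trans (leq_mul (leqnn n) leH) _.
  by rewrite -!mulnA; do 3 apply: leq_mul => //; rewrite mulnA leq_mul.
have ln2 : 0 < ln 2 :> R by rewrite ln_gt0 // ltr1n.
have le2 : ln 2 <= ln (#|gT|%:R : R).
  by rewrite ler_ln ?posrE ?ltr0n ?ler_nat // (leq_trans _ gT2).
set l := ln _ in diam le2 *; have l0 : 0 < l := lt_le_trans ln2 le2.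
have G0 : 0 < #|gT|%:R :> R by rewrite ltr0n (leq_trans _ gT2).
rewrite mulrAC ler_pdivlMr ?exprn_gt0 //.
apply: (@le_trans _ _ (l ^+ s)).
  rewrite -{2}(prednK s0) exprS ler_pM2l //.
  by apply: lerXn2r => //; rewrite nnegrE ltW.
rewrite -(ler_pM2l G0) -(@ler_pdivlMr _ (l ^+ s)) ?exprn_gt0 //.
apply: le_trans (_ : (u * m)%:R * d%:R <= _).
  by rewrite -natrM ler_nat mulnAC.
apply: le_trans (ler_wpM2l _ diam) _ => //.
by rewrite natrM le_eqVlt; apply/orP; left; apply/eqP; field; rewrite expf_neq0 // gt_eqF.
Qed.

End LogarithmicBounds.

Theorem theorem3p17 (R : realType) (k n s : nat) (lam eps : R) :
  (0 < lam)%R -> (0 < eps)%R ->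
  exists p0 : R, (p0 < 1)%R /\
    forall (gT : finGroupType) (H : {group gT}) (S : {set gT}),
      (2 <= #|gT|)%N ->
      ('L_s.+1(H) = 1)%g ->
      (#|[set: gT] : H|)%g = n ->
      (<<S>> = [set: gT])%g ->
      (#|S| <= k)%N ->
      ((cay_diam S)%:R <= lam * (#|gT|)%:R / (ln ((#|gT|)%:R : R)) ^+ s)%R ->
      forall p : R, (p0 <= p)%R -> (p <= 1)%R ->
      forall x y : gT, (1 - eps <= perc_conn_prob S p x y)%R.
Proof.
Local Open Scope ring_scope.
move=> lam0 eps0.
pose L := (2 ^ s * (3 * (n + n).+1))%N; pose M := ((2 * k).+1 ^ (L + L))%N; pose N := (M ^ 2)%N.
(* A large component of size [m] forces [#|gT| <= B ^+ m], and [Q * (4 * B) ^+ m] will bound the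
   number of roots. *)
pose a : R := lam * (n * (2 * (2 ^ s * (3 + ((n + n).+1 + (n + n).+1)))))%:R / ln 2 ^+ s.-1.
pose B := expR a; pose Q : R := (2 * k + 2 * M)%:R; pose eta := Num.min 1 (eps / Q).
have M0 : (0 < M)%N by rewrite expn_gt0.
have N0 : (0 < N)%N by rewrite expn_gt0 M0.
have Q0 : 0 < Q by rewrite ltr0n addn_gt0 !muln_gt0 M0 orbT.
have eta0 : 0 < eta by rewrite lt_min ltr01 divr_gt0.
have eta1 : eta <= 1 by rewrite ge_min lexx.
have etaQ : Q * eta <= eps by rewrite mulrC -ler_pdivlMr // ge_min lexx orbT.
have a0 : 0 <= a.
  by rewrite divr_ge0 ?exprn_ge0 ?mulr_ge0 ?ler0n ?(ltW lam0) // ln_ge0 // ler1n.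
have B1 : 1 <= B by rewrite -expR0 ler_expR.
have B0 : 0 < B by rewrite expR_gt0.
(* Chosen so that [4 * B], [N ^ 2] and [eta / V] multiply to [eta / 2]. *)
pose V : R := 8 * B * (N ^ 2)%:R.
have N1 : 1 <= (N ^ 2)%:R :> R by rewrite ler1n expn_gt0 N0.
have V1 : 1 <= V by rewrite /V -[leLHS]mulr1 ler_pM // -[leLHS]mulr1 ler_pM // ler1n.
have V0 : 0 < V := lt_le_trans ltr01 V1.
exists (1 - eta / V); split; first by rewrite ltrBlDr ltrDl divr_gt0.
move=> gT H S gT2 nilH iH genS leSk diam p lep p1 x y.
have p0 : 0 <= p.
  by apply: le_trans lep; rewrite subr_ge0 ler_pdivrMr // mul1r (le_trans eta1).
have q0 : 0 <= 1 - p by rewrite subr_ge0.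
have qV : 1 - p <= eta / V by rewrite lerBlDl -lerBlDr.
have LE : loop_length H s = L by rewrite /loop_length iH.
have ballM : (#|((1 |: cay_gens S) ^+ (L + L))%g| <= M)%N.
  by apply: leq_trans (card_ball S _) _; rewrite /M; case: (L + L)%N => // j; rewrite leq_exp2r // ltnS leq_mul2l.
have paths u v : exists q, [/\ path (adj_in (cay_edges S)) u q, uniq (u :: q) & last u q = v].
  by have /connectP[q qP ->] := cay_connected u v genS; case/shortenP: qP => q' ? ? _; exists q'.
have [q1 [q1P uq1 lq1]] := paths x y; have [q2 [q2P uq2 lq2]] := paths y x.
pose d := cay_diam S.
(* For a large size any edge may be a root; otherwise the first edges of the two simple paths
   suffice. *)
pose roots m := (if large_size H s d m then cay_edges S else finset.set0) :|:
  ([set edge_at x q1 i | i : 'I_(m ^ 2 * M)] :|: [set edge_at y q2 i | i : 'I_(m ^ 2 * M)]).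
have deg a' : (#|edge_step S L a'| <= N)%N.
  by apply: leq_trans (card_edge_step S L a') _; rewrite leq_exp2r.
have animal (w : {set {set gT}}) : ~~ connect (adj_in w) x y ->
    exists (C : {set {set gT}}) e, [/\ e \in C, C \subset cay_edges S, [disjoint C & w],
      forall e', e' \in C -> edge_conn S L C e e' & e \in roots #|C|].
  move/(closed_animal genS (cay_diam_ball genS) nilH q1P uq1 lq1 q2P uq2 lq2).
  case=> C [e [Ce sC dis conn alt]]; rewrite LE in conn alt.
  exists C, e; split=> //; rewrite /roots !finset.in_setU; case: alt => [->|[i lti ei]].
    by rewrite (fintype.subsetP sC).
  have lti' : (i < #|C| ^ 2 * M)%N by apply: leq_trans lti _; rewrite leq_mul2l ballM orbT.
  apply/orP; right; apply/orP; case: ei => ->; [left | right];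
  by apply/imsetP; exists (Ordinal lti').
apply: le_trans (perc_conn_prob_ge p0 p1 deg animal).
rewrite lerD2l lerN2.
apply: le_trans etaQ; rewrite -[leRHS]mulr1.
apply: le_trans (ler_wpM2l _ (half_geometric_sum_le1 R #|cay_edges S|)); last first.
  by rewrite mulr_ge0 ?ltW.
rewrite mulr_sumr; apply: ler_sum => -[m /= _] _.
have rootsle : #|roots m.+1|%:R <= Q * (4 * B) ^+ m.+1.
  set m' := m.+1.
  have le1 : (#|roots m'| <= (if large_size H s d m' then #|cay_edges S| else 0) + 2 * (m' ^ 2 * M))%N.
    rewrite /roots; apply: leq_trans (leq_card_setU _ _).1 _; apply: leq_add.
      by case: ifP => // _; rewrite cards0.
    apply: leq_trans (leq_card_setU _ _).1 _; rewrite mul2n -addnn.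
    by apply: leq_add; apply: leq_trans (leq_imset_card _ _) _; rewrite card_ord.
  (* [B ^+ m'] pays for all edges of the graph and [4 ^+ m'] for the factor [m' ^ 2]. *)
  apply: le_trans (_ : (2 * k)%:R * B ^+ m' + (2 * M)%:R * 4 ^+ m' <= _); last first.
    rewrite /Q natrD mulrDl exprMn; apply: lerD.
      rewrite ler_wpM2l // ler_peMl ?exprn_ge0 ?(ltW B0) // exprn_ege1 // ler1n.
      by [].
    by rewrite ler_wpM2l // ler_peMr ?exprn_ge0 ?exprn_ege1.
  move: le1; rewrite -(ler_nat R) => /le_trans; apply; rewrite natrD; apply: lerD; last first.
    by rewrite mulnCA mulnC natrM ler_wpM2l // -natrX ler_nat sqrn_le_exp4.
  case: ifP => [lg|_]; last by rewrite mulr_ge0 ?exprn_ge0 ?(ltW B0).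
  apply: (@le_trans _ _ (#|gT| * (2 * k))%:R).
    by rewrite ler_nat (leq_trans (card_cay_edges S)) // !leq_mul.
  rewrite natrM mulrC ler_wpM2l //.
  have G0 : 0 < #|gT|%:R :> R by rewrite ltr0n (leq_trans _ gT2).
  rewrite -[leLHS](lnK (x := #|gT|%:R)) ?posrE // /B -expRM_natr ler_expR.
  exact: (ln_card_le_large lam0 gT2 iH genS diam lg).
have Nle : (N ^ m.*2)%:R <= ((N ^ 2)%:R : R) ^+ m.+1.
  by rewrite -natrX ler_nat -expnM leq_pexp2l // -mul2n mulnS leq_addl.
have qle : (1 - p) ^+ m.+1 <= (eta / V) ^+ m.+1 by apply: lerXn2r; rewrite ?nnegrE // divr_ge0 ?ltW.
apply: le_trans (_ : Q * (4 * B) ^+ m.+1 * (N ^ 2)%:R ^+ m.+1 * (eta / V) ^+ m.+1 <= _).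
  by rewrite natrM ler_pM ?mulr_ge0 ?exprn_ge0 // ler_pM.
rewrite -!mulrA -!exprMn ler_pM2l //.
have ->: 4 * B * ((N ^ 2)%:R * (eta / V)) = eta * 2^-1.
  by rewrite /V; field; rewrite pnatr_eq0 -lt0n N0 gt_eqF.
(* As [eta <= 1], its power is at most [eta]; the powers of one half are left for the geometric
   sum. *)
rewrite exprMn ler_pM2r ?exprn_gt0 // exprS ler_piMr ?(ltW eta0) //.
by rewrite exprn_ile1 // ltW.
Qed.
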